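(* Let $m\ge 2$ be an integer and let $P_n=P_{-2,n}(c)$, $n\ge 0$, be the polynomials in $c$ defined by $P_0=P_1=P_3=0$, $P_2=1$ and $$(km+m+4)\,P_{k+4}(c)=2c\,(km-m+2)\,P_{k+2}(c)-(km-3m)\,P_k(c),\qquad k\ge 0 .$$ Then for every $n\ge 0$ the polynomial $P_n$ satisfies the fourth order linear differential equation (derivatives with respect to $c$) $$\begin{aligned} 0={}&16(c^2-1)^2m^2\,P_n^{(iv)}+160\,c\,(c^2-1)m^2\,P_n'''\\ &+\Bigl[8m\bigl(m(n^2-6n-2)+4(n-8)\bigr)-8c^2\bigl(m^2((n-6)n-32)+4m(n-6)+8\bigr)\Bigr]P_n''\\ &-24c\bigl(m^2(n-4)(n-2)+4m(n-6)+8\bigr)P_n'\\ &+(n^2-4)(mn-8m+4)(mn-4m+4)\,P_n . \end{aligned}$$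
   Context: The polynomials $P_{-2,n}(c)$ are the coefficients of $z^n$ in a generating function $P_{-2}(c,z)=\sum_{n\ge0}P_{-2,n}(c)z^n$ attached to the superelliptic curve $u^m=1-2ct^2+t^4$. They are determined by the initial values and recursion given in the claim. In particular $P_{-2,n}=0$ for odd $n$, and $P_{-2,4}=-\frac{2c(m-2)}{m+4}$. *)

(* Defs.v *)
From HB Require Import structures.
From mathcomp Require Import all_boot all_order all_algebra.

Set Implicit Arguments.
Unset Strict Implicit.
Unset Printing Implicit Defensive.

(* Main.v *)
Require Import Defs.
From mathcomp Require Import all_boot all_order all_algebra.
From mathcomp Require Import ring.
Import GRing.Theory.
Local Open Scope ring_scope.

(** The homogeneous recursion is that of the Gegenbauer functions of order
    -1/m and degree n/2 - 3/2 + 2/m, and P_n behaves like u_n v - w_n t, where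
    u_n, w_n are two such functions and t, v depend on c only.  The
    differentiation formula of Gegenbauer functions, applied to the factors
    u_n and w_n, is an operator on sequences; subtracting it from d/dc leaves
    an operator [ladder] that only differentiates t and v, and hence preserves
    the recursion.  The second order equation of t and v becomes a relation
    between P, [ladder] P and [ladder (ladder P)] which, by preservation of the
    recursion, only has to be checked on the initial values.  Together with the
    Gegenbauer equation in the other factor this gives a first order linear
    system of size four for P_n, from which the fourth order equation
    follows by elimination. *)

Section Ladder.

Set Implicit Arguments.
Unset Strict Implicit.

(** Serves as a linear-combination principle: [a = b] is a combination of known equations, and the
    side goal is left to [ring]. *)
Lemma eq_of_subr (V : zmodType) (x y a b : V) :
  a = b -> x - y = a - b -> x = y.
Proof. by move=> -> H; apply: subr0_eq; rewrite H subrr. Qed.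

(** The [Ei] are the iterates of the derivation [A] d/dc on [p]; solving for the plain derivatives
    with powers of [A] kept on the left avoids division. *)
Lemma deriv_chain (R : comNzRingType) (A p E1 E2 E3 E4 : {poly R}) :
  A * p^`() = E1 -> A * E1^`() = E2 -> A * E2^`() = E3 -> A * E3^`() = E4 ->
  let A1 := A^`() in let A2 := A^`()^`() in let A3 := A^`()^`()^`() in
  [/\ A ^+ 2 * p^`(2) = E2 - A1 * E1,
      A ^+ 3 * p^`(3) = E3 - 3 * A1 * E2 + (2 * A1 ^+ 2 - A * A2) * E1
    & A ^+ 4 * p^`(4) = E4 - 6 * A1 * E3 + (11 * A1 ^+ 2 - 4 * A * A2) * E2
        + (6 * A * A1 * A2 - 6 * A1 ^+ 3 - A ^+ 2 * A3) * E1].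
Proof.
move=> <- <- <- <- /=; rewrite -!derivn1 /= !(derivM, derivD).
by split; ring.
Qed.

Variables (F : fieldType) (m : nat).
Implicit Types (P : nat -> {poly F}) (k n : nat).

Local Notation M := (m%:R : {poly F}).

Definition gegenbauer_rec P := forall k,
  (k%:R * M + M + 4) * P k.+4 =
    2 * 'X * (k%:R * M - M + 2) * P k.+2 - (k%:R * M - 3 * M) * P k.

Definition ladder P n : {poly F} :=
  2 * M * ('X ^+ 2 - 1) * (P n)^`() + M * (n%:R - 3) * 'X * P n
  - (M * (n%:R - 1) + 4) * P n.+2.

Lemma deriv_nat n : (n%:R : {poly F})^`() = 0.
Proof. by rewrite -polyC_natr derivC. Qed.

Definition deriv_simp := (deriv_nat, deriv_nat 1, @derivX F, @derivXn F,
  @derivM F, @derivD F, @derivN F, @derivB F).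

Lemma natpoly_neq0 n : [pchar F] =i pred0 -> (0 < n)%N ->
  n%:R != 0 :> {poly F}.
Proof.
move=> charF0 n_gt0.
by rewrite -polyC_natr polyC_eq0 (pcharf0P F).1// -lt0n.
Qed.

Lemma gegenbauer_lead_neq0 k : [pchar F] =i pred0 ->
  k%:R * M + M + 4 != 0 :> {poly F}.
Proof.
move=> charF0; rewrite -natrM -!natrD natpoly_neq0//.
by rewrite addn_gt0 orbT.
Qed.

Lemma gegenbauer_rec_eq0 P i : [pchar F] =i pred0 -> gegenbauer_rec P ->
  P i = 0 -> P i.+2 = 0 -> forall j, P (i + j.*2)%N = 0.
Proof.
move=> charF0 recP Pi0 Pi2 j.
suff [] : P (i + j.*2)%N = 0 /\ P (i + j.*2).+2 = 0 by [].
elim: j => [|j [IH0 IH2]]; first by rewrite addn0.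
rewrite doubleS !addnS; split=> //.
apply: (mulfI (gegenbauer_lead_neq0 (i + j.*2) charF0)).
by rewrite recP IH0 IH2 !mulr0 subr0.
Qed.

Lemma deriv_gegenbauer_rec P k : gegenbauer_rec P ->
  (k%:R * M + M + 4) * (P k.+4)^`() =
    2 * 'X * (k%:R * M - M + 2) * (P k.+2)^`() + 2 * (k%:R * M - M + 2) * P k.+2
    - (k%:R * M - 3 * M) * (P k)^`().
Proof.
move=> recP; have := congr1 (@deriv F) (recP k).
rewrite !deriv_simp => H.
by apply: (eq_of_subr H); ring.
Qed.

Lemma ladder_gegenbauer_rec P : gegenbauer_rec P -> gegenbauer_rec (ladder P).
Proof.
move=> recP k; rewrite /ladder.
have H1 := deriv_gegenbauer_rec k recP.
have H2 := recP k.
have H3 := recP k.+2.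
(* The factor of [P k.+4.+2] in [ladder P k.+4] is exactly the leading coefficient of the recursion
   at [k.+2], so this term is eliminated without dividing. *)
have H4 : (M * (k.+4%:R - 1) + 4) * P k.+4.+2 =
  2 * 'X * (k.+2%:R * M - M + 2) * P k.+4
  - (k.+2%:R * M - 3 * M) * P k.+2.
  by rewrite -H3; ring.
rewrite H4.
by apply: (eq_of_subr
  (congr2 +%R (congr1 ( *%R (2 * M * ('X ^+ 2 - 1))) H1)
              (congr1 ( *%R (M * (k%:R - 3) * 'X)) H2))); ring.
Qed.

(** The coefficients on the right do not involve [n], so the difference [S] of both sides again
    satisfies the recursion and vanishes at even indices once it does at 0 and 2. Comparing values
    at 0, where [P] vanishes, suggests the coefficient of [ladder P]; index 2 then suggests that of
    [P]. *)
Lemma ladder2 P n : [pchar F] =i pred0 -> gegenbauer_rec P ->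
  P 0%N = 0 -> P 2%N = 1 -> ~~ odd n ->
  ladder (ladder P) n =
    - (2 * M + 4) * 'X * ladder P n + 5 * M * (M - 4) * ('X ^+ 2 - 1) * P n.
Proof.
move=> charF0 recP P0 P2 even_n; apply/eqP; rewrite -subr_eq0; apply/eqP.
pose S k := ladder (ladder P) k -
  (- (2 * M + 4) * 'X * ladder P k + 5 * M * (M - 4) * ('X ^+ 2 - 1) * P k).
have recL := ladder_gegenbauer_rec recP.
have recS : gegenbauer_rec S.
  move=> k; rewrite /S.
  have H1 := recP k; have H2 := recL k.
  have H3 := ladder_gegenbauer_rec recL k.
  by apply: (eq_of_subr
    (congr2 +%R H3 (congr2 +%R
      (congr1 ( *%R ((2 * M + 4) * 'X)) H2)
      (congr1 ( *%R (- (5 * M * (M - 4) * ('X ^+ 2 - 1)))) H1)))); ring.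
have P4 : (M + 4) * P 4%N = 2 * 'X * (2 - M).
  by have := recP 0%N; rewrite P0 P2 => /eq_of_subr; apply; ring.
have L0 : ladder P 0%N = M - 4 by rewrite /ladder P0 P2 deriv0; ring.
have L2 : ladder P 2%N = (M - 4) * 'X.
  rewrite /ladder P2 (deriv_nat 1).
  by apply: (eq_of_subr (congr1 -%R P4)); ring.
have L4 : (M + 4) * ladder P 4%N =
    2 * 'X * (2 - M) * ladder P 2%N + 3 * M * ladder P 0%N.
  by have /eq_of_subr := recL 0%N; apply; ring.
have dL0 : (ladder P 0%N)^`() = 0 by rewrite L0 derivB !deriv_nat subr0.
have dL2 : (ladder P 2%N)^`() = M - 4.
  by rewrite L2 derivM derivB !deriv_nat derivX; ring.
have S0 : S 0%N = 0.
  by rewrite /S {1}/ladder dL0 L0 L2 P0; ring.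
have S2 : S 2%N = 0.
  rewrite L0 L2 in L4.
  rewrite /S {1}/ladder dL2 L2 P2.
  by apply: (eq_of_subr (congr1 -%R L4)); ring.
rewrite -(even_halfK even_n).
exact: (gegenbauer_rec_eq0 charF0 recS S0 S2).
Qed.

(** [n_ladder P n] is 2m(c^2-1) times the derivative that only acts on the
    factors depending on n. *)
Definition n_ladder P n : {poly F} :=
  (M * (n%:R - 1) + 4) * P n.+2 - M * (n%:R - 3) * 'X * P n.

Lemma deriv_ladder P n :
  2 * M * ('X ^+ 2 - 1) * (P n)^`() = n_ladder P n + ladder P n.
Proof. by rewrite /n_ladder /ladder; ring. Qed.

(** The term [n_ladder (ladder P) n] is the mixed derivative, acting once on each kind of factor;
    the other terms express the Gegenbauer equation of the factors depending on [n]. *)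
Lemma deriv_n_ladder P n : gegenbauer_rec P ->
  2 * M * ('X ^+ 2 - 1) * (n_ladder P n)^`() =
    n_ladder (ladder P) n + (2 * M + 4) * 'X * n_ladder P n
    + M * (n%:R - 3) * (M * n%:R - 3 * M + 4) * ('X ^+ 2 - 1) * P n.
Proof.
move=> recP; rewrite /n_ladder.
rewrite !deriv_simp.
have H1 := recP n.
rewrite /ladder.
have H2 : (M * (n.+2%:R - 1) + 4) * P n.+4 =
   2 * 'X * (n%:R * M - M + 2) * P n.+2 - (n%:R * M - 3 * M) * P n.
  by rewrite -H1; ring.
rewrite H2; ring.
Qed.

(** The iterates of [A] d/dc on [p] stay in the span of [p], [U], [R], [V], so five of them are
    linearly dependent. The prefactor [A ^+ 2] makes the leading coefficient [4 * A ^+ 4], as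
    [deriv_chain] needs. *)
Lemma gegenbauer_system_ode n (p U R V : {poly F}) :
  let A := 2 * M * ('X ^+ 2 - 1) in
  let N := n%:R : {poly F} in
  let c := 'X : {poly F} in
  let g := (2 * M + 4) * c in
  let f := 5 * M * (M - 4) * (c ^+ 2 - 1) in
  let h := M * (N - 3) * (M * N - 3 * M + 4) * (c ^+ 2 - 1) in
  A * p^`() = U + R -> A * U^`() = V + g * U + h * p ->
  A * R^`() = V - g * R + f * p -> A * V^`() = h * R + f * U ->
  A ^+ 2 *
   (16 * (c ^+ 2 - 1) ^+ 2 * M ^+ 2 * p^`(4)
    + 160 * c * (c ^+ 2 - 1) * M ^+ 2 * p^`(3)
    + (8 * M * (M * (N ^+ 2 - 6 * N - 2) + 4 * (N - 8))
       - 8 * c ^+ 2 * (M ^+ 2 * ((N - 6) * N - 32) + 4 * M * (N - 6) + 8))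
      * p^`(2)
    - 24 * c * (M ^+ 2 * (N - 4) * (N - 2) + 4 * M * (N - 6) + 8) * p^`()
    + (N ^+ 2 - 4) * (M * N - 8 * M + 4) * (M * N - 4 * M + 4) * p) = 0.
Proof.
move=> A N c g f h Hp HU HR HV.
have dA : A^`() = 4 * M * c by rewrite /A /c !deriv_simp; ring.
have ddA : A^`()^`() = 4 * M by rewrite dA /c !deriv_simp; ring.
have dddA : A^`()^`()^`() = 0 by rewrite ddA !deriv_simp; ring.
pose E2 := 2 * V + g * U - g * R + (h + f) * p.
have HE1 : A * (U + R)^`() = E2.
  by rewrite derivD mulrDr HU HR /E2; ring.
(* In the third iterate the contributions [g * V] from [U] and [R] cancel, leaving only [U], [R] and
   [p]. *)
pose a := 3 * f + h + (2 * M + 4) * A + g ^+ 2.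
pose b := 3 * h + f - (2 * M + 4) * A + g ^+ 2.
pose q := g * (h - f) + 2 * c *
  (M * (N - 3) * (M * N - 3 * M + 4) + 5 * M * (M - 4)) * A.
pose E3 := a * U + b * R + q * p.
have HE2 : A * E2^`() = E3.
  have -> : A * E2^`() = 2 * (A * V^`()) + g * (A * U^`()) - g * (A * R^`())
    + (h + f) * (A * p^`()) + A * (g^`() * (U - R) + (h^`() + f^`()) * p).
    by rewrite /E2 !deriv_simp; ring.
  rewrite Hp HU HR HV /E3 /a /b /q /h /f /g /c /N !deriv_simp; ring.
pose E4 := a * (A * U^`()) + b * (A * R^`()) + q * (A * p^`())
    + A * (a^`() * U + b^`() * R + q^`() * p).
have HE3 : A * E3^`() = E4 by rewrite /E4 /E3 !deriv_simp; ring.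
have [H2 H3 H4] := deriv_chain Hp HE1 HE2 HE3.
transitivity (4 * (A ^+ 4 * p^`(4)) + 80 * c * M * (A ^+ 3 * p^`(3))
  + (8 * M * (M * (N ^+ 2 - 6 * N - 2) + 4 * (N - 8))
       - 8 * c ^+ 2 * (M ^+ 2 * ((N - 6) * N - 32) + 4 * M * (N - 6) + 8))
      * (A ^+ 2 * p^`(2))
  - 24 * c * (M ^+ 2 * (N - 4) * (N - 2) + 4 * M * (N - 6) + 8) * A
      * (A * p^`())
  + (N ^+ 2 - 4) * (M * N - 8 * M + 4) * (M * N - 4 * M + 4) * A ^+ 2 * p).
  by rewrite /A /c; ring.
rewrite H2 H3 H4 Hp dddA ddA dA /E4 HU HR Hp.
have -> : a^`() = 2 * c * (3 * (5 * M * (M - 4))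
   + M * (N - 3) * (M * N - 3 * M + 4)) + (2 * M + 4) * (4 * M * c)
   + 2 * (2 * M + 4) ^+ 2 * c.
  by rewrite /a /f /h /g /A /c /N !deriv_simp; ring.
have -> : b^`() = 2 * c * (5 * M * (M - 4)
   + 3 * (M * (N - 3) * (M * N - 3 * M + 4))) - (2 * M + 4) * (4 * M * c)
   + 2 * (2 * M + 4) ^+ 2 * c.
  by rewrite /b /f /h /g /A /c /N !deriv_simp; ring.
have -> : q^`() =
   (M * (N - 3) * (M * N - 3 * M + 4) - 5 * M * (M - 4)) * (2 * M + 4)
     * (3 * c ^+ 2 - 1)
   + (M * (N - 3) * (M * N - 3 * M + 4) + 5 * M * (M - 4))
     * (4 * M) * (3 * c ^+ 2 - 1).
  by rewrite /q /f /h /g /A /c /N !deriv_simp; ring.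
rewrite /E3 /E2 /q /a /b /h /f /g /A /c; ring.
Qed.

End Ladder.

Theorem theorem2p3 (F : fieldType) (charF0 : [pchar F] =i pred0)
  (m : nat) (hm : (2 <= m)%N) (P : nat -> {poly F})
  (hP0 : P 0%N = 0) (hP1 : P 1%N = 0) (hP2 : P 2%N = 1) (hP3 : P 3%N = 0)
  (hrec : forall k : nat,
     (k%:R * m%:R + m%:R + 4) * P (k + 4)%N =
       2 * 'X * (k%:R * m%:R - m%:R + 2) * P (k + 2)%N
       - (k%:R * m%:R - 3 * m%:R) * P k)
  (n : nat) :
  let M : {poly F} := m%:R in
  let N : {poly F} := n%:R in
  let c : {poly F} := 'X in
  0 = 16 * (c ^+ 2 - 1) ^+ 2 * M ^+ 2 * (P n)^`(4)
      + 160 * c * (c ^+ 2 - 1) * M ^+ 2 * (P n)^`(3)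
      + (8 * M * (M * (N ^+ 2 - 6 * N - 2) + 4 * (N - 8))
         - 8 * c ^+ 2 * (M ^+ 2 * ((N - 6) * N - 32) + 4 * M * (N - 6) + 8))
        * (P n)^`(2)
      - 24 * c * (M ^+ 2 * (N - 4) * (N - 2) + 4 * M * (N - 6) + 8) * (P n)^`()
      + (N ^+ 2 - 4) * (M * N - 8 * M + 4) * (M * N - 4 * M + 4) * P n.
Proof.
move=> M N c.
have recP : gegenbauer_rec m P.
  by move=> k; have := hrec k; rewrite !addnS addn0.
case: (boolP (odd n)) => [odd_n|even_n].
  have -> : P n = 0.
    rewrite -(odd_double_half n) odd_n.
    exact: (gegenbauer_rec_eq0 charF0 recP hP1 hP3).
  by rewrite !linear0 !mulr0 !addr0 subr0.
set A : {poly F} := 2 * M * ('X ^+ 2 - 1).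
have A_neq0 : A ^+ 2 != 0.
  have m_gt0 : (0 < m)%N by apply: leq_trans hm.
  rewrite expf_neq0// !mulf_neq0 ?natpoly_neq0//.
  by rewrite monic_neq0// -polyC1 monicXnsubC.
apply: (mulfI A_neq0); rewrite mulr0; apply/esym.
have recL := ladder_gegenbauer_rec recP.
have L2 := ladder2 charF0 recP hP0 hP2 even_n.
apply: (gegenbauer_system_ode (U := n_ladder m P n) (R := ladder m P n)
          (V := n_ladder m (ladder m P) n)).
- exact: deriv_ladder.
- exact: deriv_n_ladder.
- by rewrite deriv_ladder L2; ring.
(* [n_ladder] of [ladder (ladder P)] reaches index [n.+2], so the second order relation is used at
   both [n] and [n.+2]. *)
- have L2' := ladder2 (n := n.+2) charF0 recP hP0 hP2.
  rewrite (deriv_n_ladder _ recL) /n_ladder L2 L2' /= ?negbK//.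
  by ring.
Qed.
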